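(* Let $p\le n$ be positive integers, let $X\in\mathrm{Sp}(2p,2n)$, and let $X_\perp\in\mathbb{R}^{2n\times(2n-2p)}$ be a full rank matrix such that $\mathrm{span}(X_\perp)$ is the orthogonal complement of $\mathrm{span}(X)$ in $\mathbb{R}^{2n}$. Then the tangent space of $\mathrm{Sp}(2p,2n)$ at $X$ admits the following expressions: $$\mathrm{T}_X\mathrm{Sp}(2p,2n)=\{Z\in\mathbb{R}^{2n\times 2p}: Z^\top J_{2n}X+X^\top J_{2n}Z=0\}$$ $$=\{XJ_{2p}W+J_{2n}X_\perp K: W\in\mathcal{S}_{\mathrm{sym}}(2p),\ K\in\mathbb{R}^{(2n-2p)\times 2p}\}$$ $$=\{SJ_{2n}X: S\in\mathcal{S}_{\mathrm{sym}}(2n)\}.$$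
   Context: For a positive integer $m$, $J_{2m}=\begin{bmatrix}0&I_m\\-I_m&0\end{bmatrix}$, and $\mathcal{S}_{\mathrm{sym}}(m)$ is the set of symmetric $m\times m$ real matrices. The symplectic Stiefel manifold is $\mathrm{Sp}(2p,2n)=\{X\in\mathbb{R}^{2n\times 2p}: X^\top J_{2n}X=J_{2p}\}$, an embedded submanifold of $\mathbb{R}^{2n\times 2p}$. Its tangent space at $X$ is $\mathrm{T}_X\mathrm{Sp}(2p,2n)=\{\gamma'(0):\gamma \text{ a smooth curve in } \mathrm{Sp}(2p,2n) \text{ with } \gamma(0)=X\}$. $\mathrm{span}(A)$ denotes the subspace spanned by the columns of $A$. When $p=n$, $X_\perp$ is the empty matrix and the terms involving it are absent. *)

(* Defs.v *)
From HB Require Import structures.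
From mathcomp Require Import all_boot all_order all_algebra.
From mathcomp Require Import all_classical all_reals all_analysis.

Set Implicit Arguments.
Unset Strict Implicit.
Unset Printing Implicit Defensive.

Import Order.TTheory GRing.Theory Num.Theory.
Import numFieldNormedType.Exports.

Local Open Scope classical_set_scope.
Local Open Scope ring_scope.

(* R^{2m x 2k} is rendered as 'M[R]_(m + m, k + k), so that J_{2m} is literally
   a block matrix. *)
Definition Jmx (R : realType) (m : nat) : 'M[R]_(m + m) :=
  block_mx 0 1%:M (- 1%:M) 0.

Definition Ssym (R : realType) (m : nat) : set 'M[R]_m :=
  [set A | A \is symmetricmx].

Definition Sp (R : realType) (p n : nat) : set 'M[R]_(n + n, p + p) :=
  [set X | X^T *m Jmx R n *m X = Jmx R p].

Definition colspan (R : realType) (m k : nat) (A : 'M[R]_(m, k)) :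
    set 'cV[R]_m :=
  [set A *m c | c in [set: 'cV[R]_k]].

Definition orthocompl (R : realType) (m : nat) (V : set 'cV[R]_m) :
    set 'cV[R]_m :=
  [set w | forall v, V v -> v^T *m w = 0].

(* C^oo on an open set I: all iterated derivatives exist at each point of I.
   As I is open, these only depend on the restriction of f to I. *)
Definition smooth_on (R : realType) (V : normedModType R) (I : set R)
    (f : R -> V) : Prop :=
  forall (k : nat) (t : R), I t -> derivable (f^`(k)%classic) t 1.

(* The initial velocities of the smooth curves ]-e, e[ -> M through X, for an
   embedded submanifold M of V: such a curve is smooth as a map into M iff it is
   smooth as a map into V. *)
Definition tangent_space (R : realType) (V : normedModType R) (M : set V)
    (X : V) : set V :=
  [set Z | exists (e : R) (gamma : R -> V),
    [/\ 0 < e,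
        smooth_on `]- e, e[%classic gamma,
        forall t, t \in `]- e, e[ -> M (gamma t),
        gamma 0 = X &
        gamma^`()%classic 0 = Z]].

(* Main.v *)
Require Import Defs.
From HB Require Import structures.
From mathcomp Require Import all_boot all_order all_algebra.
From mathcomp Require Import all_classical all_reals all_analysis.

Set Implicit Arguments.
Unset Strict Implicit.
Unset Printing Implicit Defensive.

Import Order.TTheory GRing.Theory Num.Theory.
Import numFieldNormedType.Exports.

Local Open Scope classical_set_scope.
Local Open Scope ring_scope.

(** Call linearised equation the condition Z^T J X + X^T J Z = 0 obtained by
    differentiating X^T J X = J, where J stands for the standard skew matrix of
    either size. The proof turns around the form S J X of its solutions.

    Every velocity of a curve in Sp satisfies the linearised equation, by the
    product rule ([tangent_Sp_linearized]). Conversely, a solution Z can be written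
    S J X with S symmetric ([linearized_Hamiltonian]), by an explicit formula that
    uses the left inverse - J X^T of J X. Such a Z is the velocity at 0 of an
    explicit curve of Sp: with B = S J / 2, the Cayley transform
    (1 - t B)^-1 (1 + t B) = 2 (1 - t B)^-1 - 1 preserves the form J and has
    derivative 2 B = S J at 0; the curve is its product with X
    ([Cayley_preserves_form], [Hamiltonian_tangent_Sp]). The curve is smooth because
    the derivatives of the resolvent M = (1 - t B)^-1 are explicit: M' = M B M, and
    the k-th derivative is k! (M B)^k M. That M is differentiable at all comes from
    Cramer's rule.

    For the second description, the part of a solution Z outside of X J W, with
    W = - X^T J Z symmetric, is mapped by J into the orthogonal complement of
    span X, which is the column span of the given complement matrix
    ([linearized_decomposition]). The reverse inclusions are computations with
    J^2 = -1 and J^T = -J. *)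

(** * Calculus of matrix-valued functions *)

Lemma is_derive_mxP (R : realFieldType) (V : normedModType R) (m n : nat)
    (M : V -> 'M[R]_(m, n)) (t v : V) (dM : 'M[R]_(m, n)) :
  is_derive t v M dM <->
  forall i j, is_derive t v (fun x => M x i j) (dM i j).
Proof.
split=> [[dM1 <-] i j|Mij].
  apply: DeriveDef; first exact: (derivable_mxP M t v).1 dM1 i j.
  by rewrite derive_mx// mxE.
have dM1 : derivable M t v by apply/derivable_mxP => i j; exact: ex_derive.
apply: DeriveDef => //; rewrite derive_mx//; apply/matrixP => i j.
by rewrite mxE derive_val.
Qed.

Lemma is_derive_mulmx (R : realFieldType) (V : normedModType R) (m n q : nat)
    (f : V -> 'M[R]_(m, n)) (g : V -> 'M[R]_(n, q)) (t v : V)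
    (df : 'M[R]_(m, n)) (dg : 'M[R]_(n, q)) :
  is_derive t v f df -> is_derive t v g dg ->
  is_derive t v (fun x => f x *m g x) (df *m g t + f t *m dg).
Proof.
move=> /is_derive_mxP f' /is_derive_mxP g'; apply/is_derive_mxP => i j.
have -> : (fun x => (f x *m g x) i j) =
    \sum_k ((fun x => f x i k) * (fun x => g x k j)).
  by apply/funext => x; rewrite mxE fct_sumE.
rewrite !mxE -big_split /=.
apply: is_derive_sum => k; apply: is_derive_eq.
by rewrite addrC; congr (_ + _); rewrite mulrC.
Qed.

Lemma is_derive_trmx (R : realFieldType) (V : normedModType R) (m n : nat)
    (f : V -> 'M[R]_(m, n)) (t v : V) (df : 'M[R]_(m, n)) :
  is_derive t v f df -> is_derive t v (fun x => (f x)^T) df^T.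
Proof.
move=> /is_derive_mxP f'; apply/is_derive_mxP => i j; rewrite mxE.
have -> : (fun x => (f x)^T i j) = (fun x => f x j i).
  by apply/funext => x; rewrite mxE.
exact: f'.
Qed.

(** Reduces smoothness to a guess of all the iterated derivatives, each checked
    against the next: openness of I lets the k-th derivative be replaced by F k
    near a point before differentiating once more. *)
Lemma smooth_on_derivative_sequence (R : realType) (V : normedModType R) (I : set R)
    (F : nat -> R -> V) : open I ->
  (forall k t, I t -> is_derive t 1 (F k) (F k.+1 t)) -> smooth_on I (F 0%N).
Proof.
move=> oI F' k t It.
have nearI s : I s -> \forall u \near s, I u by move=> Is; exact: open_nbhs_nbhs.
have FE : forall s, I s -> (F 0%N)^`(k)%classic s = F k s.
  elim: k => // k IH s Is; rewrite derive1nS derive1E.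
  rewrite (near_eq_derive _ (g := F k)); last first.
    by apply: filterS (nearI _ Is) => u; exact: IH.
  by have [] := F' k s Is.
apply: (@near_eq_derivable _ _ _ (F k)); last by have [] := F' k t It.
by apply: filterS (nearI _ It) => s /FE.
Qed.

(** * The resolvent of a matrix *)

(** A matrix that is polynomial in s is singular exactly at the roots of a
    polynomial, its determinant, so invertibility is an open condition on s. *)
Lemma near_unit_horner_mx (R : realFieldType) (n : nat)
    (P : 'M[{poly R}]_n) (t : R) :
  map_mx (horner_eval t) P \in unitmx ->
  \forall s \near t, map_mx (horner_eval s) P \in unitmx.
Proof.
move=> Pt.
have det_horner s : \det (map_mx (horner_eval s) P) = (\det P).[s].
  by rewrite det_map_mx.
have : (\det P).[t] != 0 by rewrite -det_horner -unitfE.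
move=> /(cvgr_neq0 _ (@continuous_horner _ (\det P) t)).
by apply: filterS => s; rewrite /= -det_horner -unitfE.
Qed.

(** By Cramer's rule the entries of the inverse are quotients of polynomials,
    with a denominator that does not vanish near t. *)
Lemma derivable_invmx_horner (R : realFieldType) (n : nat)
    (P : 'M[{poly R}]_n) (t : R) :
  map_mx (horner_eval t) P \in unitmx ->
  derivable (fun s : R => invmx (map_mx (horner_eval s) P)) t 1.
Proof.
move=> Pt.
have det_horner s : \det (map_mx (horner_eval s) P) = (\det P).[s].
  by rewrite det_map_mx.
apply: (@near_eq_derivable _ _ _
    (fun s : R => (\det P).[s]^-1 *: map_mx (horner_eval s) (\adj P))).
  near=> s.
  have Ps : map_mx (horner_eval s) P \in unitmx.
    by near: s; exact: near_unit_horner_mx.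
  by rewrite /invmx Ps det_horner map_mx_adj.
apply/derivable_mxP => i j.
have -> : (fun s : R => ((\det P).[s]^-1 *: map_mx (horner_eval s) (\adj P)) i j)
    = (fun s => (\det P).[s]^-1) * horner (\adj P i j).
  by apply/funext => s; rewrite 2!mxE.
apply: derivableM; last exact: derivable_horner.
apply: derivableV; last exact: derivable_horner.
by rewrite -det_horner -unitfE.
Unshelve. all: by end_near. Qed.

(** Writes the pencil 1 - s B as a polynomial matrix evaluated at s, which makes
    the two lemmas above apply to the resolvent (1 - s B)^-1. *)
Lemma resolvent_horner (R : realFieldType) (n : nat) (B : 'M[R]_n) (s : R) :
  map_mx (horner_eval s) (1%:M - 'X *: map_mx polyC B) = 1%:M - s *: B.
Proof.
apply/matrixP => i j; rewrite !mxE /horner_eval !hornerE.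
by rewrite -[in LHS]polyC_natr hornerC.
Qed.

Lemma near_unit_resolvent (R : realFieldType) (n : nat) (B : 'M[R]_n) (t : R) :
  1%:M - t *: B \in unitmx -> \forall s \near t, 1%:M - s *: B \in unitmx.
Proof.
rewrite -resolvent_horner => /near_unit_horner_mx.
by apply: filterS => s; rewrite resolvent_horner.
Qed.

Lemma is_derive_resolvent (R : realFieldType) (n : nat) (B : 'M[R]_n) (t : R) :
  1%:M - t *: B \in unitmx ->
  let M s := invmx (1%:M - s *: B) in is_derive t 1 M (M t *m B *m M t).
Proof.
move=> Ut M.
have M' : is_derive t 1 M ('D_1 M t).
  apply: derivableP; rewrite /M; under eq_fun do rewrite -resolvent_horner.
  by apply: derivable_invmx_horner; rewrite resolvent_horner.
have U' : is_derive t 1 (fun s => 1%:M - s *: B) (- B).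
  apply/is_derive_mxP => i j.
  have -> : (fun s => (1%:M - s *: B) i j) =
      cst ((1%:M : 'M[R]_n) i j) - B i j \*: id.
    by apply/funext => s; rewrite !mxE !fctE /= [s * _]mulrC.
  apply: is_derive_eq; rewrite !mxE sub0r; congr (- _).
  exact: mulr1.
(* M (1 - s B) is constant near t, so its two derivatives, by the product rule
   and by constancy, agree; this determines M' since 1 - t B is invertible. *)
have [_ dMU] := is_derive_mulmx M' U'.
have [_ dMU0] : is_derive t 1 (fun s => M s *m (1%:M - s *: B)) 0.
  apply: (@near_eq_is_derive _ _ _ (cst 1%:M)).
    near=> s; rewrite /= mulVmx//.
    by near: s; exact: near_unit_resolvent.
have /eqP := etrans (esym dMU) dMU0; rewrite mulmxN subr_eq0 => /eqP MU.
by rewrite -(mulmxK Ut ('D_1 M t)) MU in M'.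
Unshelve. all: by end_near. Qed.

(** The iterates (M B)^k M X are, up to factorials, the successive derivatives of
    M X, where M = (1 - s B)^-1: each of the k + 1 factors M of the product
    contributes one more M B M, and all these contributions are equal. *)
Lemma is_derive_iter_resolvent (R : realFieldType) (n q : nat)
    (B : 'M[R]_n) (X : 'M[R]_(n, q)) (t : R) (k : nat) :
  1%:M - t *: B \in unitmx ->
  let M s := invmx (1%:M - s *: B) in
  let F j s := iter j (mulmx (M s *m B)) (M s *m X) in
  is_derive t 1 (F k) (k.+1%:R *: F k.+1 t).
Proof.
move=> Ut M F; have M' := is_derive_resolvent Ut.
have J' (m l : nat) (C : 'M[R]_(m, l)) : is_derive (t : R) 1 (cst C) 0.
  exact: is_derive_cst.
elim: k => [|k IH].
  have := is_derive_mulmx M' (J' _ _ X).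
  by rewrite mulmx0 addr0 -!mulmxA scale1r /F /= !mulmxA.
have := is_derive_mulmx (is_derive_mulmx M' (J' _ _ B)) IH.
rewrite mulmx0 addr0 -scalemxAr -!mulmxA => H.
by rewrite -[k.+2]add1n natrD scalerDl scale1r; move: H; rewrite /F /= !mulmxA.
Qed.

(** * The symplectic form *)

Lemma trmx_Jmx (R : realType) m : (Jmx R m)^T = - Jmx R m.
Proof.
by rewrite /Jmx tr_block_mx !trmx0 linearN /= !trmx1 opp_block_mx !oppr0 opprK.
Qed.

Lemma mulmx_JJ (R : realType) m : Jmx R m *m Jmx R m = - 1%:M.
Proof.
rewrite /Jmx mulmx_block !(mul0mx, mulmx0, mul1mx, mulmx1) !(addr0, add0r).
by rewrite scalar_mx_block opp_block_mx oppr0.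
Qed.

Lemma SsymP (R : realType) m (A : 'M[R]_m) : Ssym A <-> A^T = A.
Proof.
rewrite /Ssym /= is_hermitianmxE expr0 scale1r map_mx_id //.
by split => [/eqP/esym|->].
Qed.

(** With U = 1 - A and V = 1 + A, the matrix C is the Cayley transform U^-1 V. The
    hypothesis says that A is skew for the form J, so passing J from right to left
    exchanges U and V; as U and V commute, V^T J V = J U V = U^T J U. *)
Lemma Cayley_preserves_form (R : comUnitRingType) (n : nat) (J A : 'M[R]_n) :
  A^T *m J = - (J *m A) -> 1%:M - A \in unitmx ->
  let C := 2 *: invmx (1%:M - A) - 1%:M in C^T *m J *m C = J.
Proof.
move=> AJ Uu C; pose U : 'M[R]_n := 1%:M - A; pose V : 'M[R]_n := 1%:M + A.
have UJ : U^T *m J = J *m V.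
  by rewrite /U /V linearB /= trmx1 mulmxBl mulmxDr mul1mx mulmx1 AJ opprK.
have VJ : V^T *m J = J *m U.
  by rewrite /U /V linearD /= trmx1 mulmxDl mulmxBr mul1mx mulmx1 AJ.
have CU : C *m U = V.
  rewrite /C mulmxBl -scalemxAl mulVmx// mul1mx /U /V.
  by rewrite opprB scaler_nat mulr2n addrA addrAC addrK.
have UV : U *m V = V *m U.
  by rewrite /U /V mulmxBl mulmxBr !mulmxDr !mulmxDl !mul1mx !mulmx1.
(* A congruence by the invertible U clears the inverse in C, as C U = V. *)
have : U^T *m (C^T *m J *m C) *m U = U^T *m J *m U.
  rewrite !mulmxA -trmx_mul -mulmxA CU UJ VJ.
  by rewrite -!mulmxA UV.
by move=> /(can_inj (mulmxK Uu)) /(can_inj (mulKmx _)); apply; rewrite unitmx_tr.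
Qed.

(** * Solutions of the linearised equation *)

(** The symmetric S has to send Y := J X to Z. The matrix Y has a left inverse
    since X^T J X = J, and the linearised equation says that Y^T Z is symmetric,
    which is exactly what makes the symmetric interpolation problem S Y = Z
    solvable. *)
Lemma linearized_Hamiltonian (R : realType) (p n : nat)
    (X Z : 'M[R]_(n + n, p + p)) :
  Sp X -> Z^T *m Jmx R n *m X + X^T *m Jmx R n *m Z = 0 ->
  exists S : 'M[R]_(n + n), Ssym S /\ Z = S *m Jmx R n *m X.
Proof.
move=> XX XZ; set J := Jmx R n; set Jp := Jmx R p.
pose L := - (Jp *m X^T).
have LJX : L *m (J *m X) = 1%:M.
  by rewrite /L mulNmx -!mulmxA [X^T *m _]mulmxA XX mulmx_JJ opprK.
pose Q := Z^T *m (J *m X).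
have QT : Q^T = Q.
  rewrite /Q !trmx_mul trmxK trmx_Jmx mulmxN mulNmx.
  by apply/eqP; rewrite eqr_oppLR -addr_eq0 mulmxA addrC XZ.
(* Z L already maps J X to Z and its transpose is added to symmetrise; the last
   term undoes what that transpose does on J X. *)
pose S := Z *m L + (Z *m L)^T - L^T *m Q *m L.
exists S; split.
  apply/SsymP; rewrite /S linearB linearD /= trmxK [(Z *m L)^T + _]addrC.
  by rewrite (trmx_mul (L^T *m Q)) (trmx_mul L^T) trmxK QT mulmxA.
rewrite -mulmxA /S mulmxBl mulmxDl -!mulmxA LJX !mulmx1 trmx_mul -mulmxA.
by rewrite addrK.
Qed.

Lemma Hamiltonian_linearized (R : realType) (p n : nat)
    (X : 'M[R]_(n + n, p + p)) (S : 'M[R]_(n + n)) :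
  Ssym S ->
  let Z := S *m Jmx R n *m X in
  Z^T *m Jmx R n *m X + X^T *m Jmx R n *m Z = 0.
Proof.
move=> /SsymP ST Z; rewrite /Z !trmx_mul ST trmx_Jmx !mulNmx !mulmxN !mulNmx.
by rewrite !mulmxA addNr.
Qed.

Lemma orthocompl_colspan_mulmx0 (R : realType) (m k l : nat)
    (A : 'M[R]_(m, k)) (Y : 'M[R]_(m, l)) :
  colspan Y = orthocompl (colspan A) -> A^T *m Y = 0.
Proof.
move=> YA; apply/matrixP => i j; rewrite mxE.
have : orthocompl (colspan A) (Y *m delta_mx j 0).
  by rewrite -YA; exists (delta_mx j 0).
move=> /(_ (A *m delta_mx i 0)) /= H.
have /matrixP/(_ 0 0) := H (ex_intro2 _ _ _ I erefl).
rewrite trmx_mul -mulmxA [_ *m (Y *m _)]mulmxA trmx_delta -rowE -colE.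
by rewrite !mxE.
Qed.

(** Once the component X J W has been removed from Z, the remainder V satisfies
    X^T J V = 0: the columns of J V are orthogonal to those of X, hence
    combinations of the columns of Y. *)
Lemma linearized_decomposition (R : realType) (p n k : nat)
    (X Z : 'M[R]_(n + n, p + p)) (Y : 'M[R]_(n + n, k)) :
  Sp X -> colspan Y = orthocompl (colspan X) ->
  Z^T *m Jmx R n *m X + X^T *m Jmx R n *m Z = 0 ->
  exists (W : 'M[R]_(p + p)) (K : 'M[R]_(k, p + p)),
    Ssym W /\ Z = X *m Jmx R p *m W + Jmx R n *m Y *m K.
Proof.
move=> XX XY XZ; set J := Jmx R n; set Jp := Jmx R p.
(* The only candidate: multiply Z = X J W + J Y K by X^T J on the left. *)
pose W := - (X^T *m J *m Z).
have WT : W^T = W.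
  rewrite /W linearN /= !trmx_mul trmxK trmx_Jmx mulNmx mulmxN opprK mulmxA.
  by apply/eqP; rewrite -addr_eq0 XZ.
pose V := Z - X *m Jp *m W.
have XV : X^T *m (J *m V) = 0.
  rewrite /V !mulmxBr !mulmxA XX mulmx_JJ mulNmx mul1mx.
  by rewrite /W opprK subrr.
have /choice[c Yc] : forall j, exists c, Y *m c = col j (J *m V).
  move=> j; have : orthocompl (colspan X) (col j (J *m V)).
    move=> _ [c _ <-]; rewrite trmx_mul -mulmxA.
    by rewrite colE [X^T *m _]mulmxA XV mul0mx mulmx0.
  by rewrite -XY => -[c _ Yc]; exists c.
pose K := \matrix_(i, j) c j i 0.
have YK : Y *m K = J *m V.
  apply/matrixP => i j; have /matrixP/(_ i 0) := Yc j; rewrite !mxE => <-.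
  by under eq_bigr do rewrite mxE.
exists W, (- K); split; first exact/SsymP.
rewrite (mulmxN _ K) -[_ *m Y *m K]mulmxA YK mulmxA mulmx_JJ mulNmx mul1mx opprK /V.
by rewrite addrC subrK.
Qed.

Lemma decomposition_linearized (R : realType) (p n k : nat)
    (X : 'M[R]_(n + n, p + p)) (Y : 'M[R]_(n + n, k))
    (W : 'M[R]_(p + p)) (K : 'M[R]_(k, p + p)) :
  Sp X -> X^T *m Y = 0 -> Ssym W ->
  let Z := X *m Jmx R p *m W + Jmx R n *m Y *m K in
  Z^T *m Jmx R n *m X + X^T *m Jmx R n *m Z = 0.
Proof.
move=> XX XY /SsymP WT; set J := Jmx R n; set Jp := Jmx R p => Z.
have XJZ : X^T *m J *m Z = - W.
  rewrite /Z mulmxDr !mulmxA XX mulmx_JJ mulNmx mul1mx.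
  rewrite -[_ *m J *m J]mulmxA mulmx_JJ mulmxN mulmx1 mulNmx XY.
  by rewrite oppr0 mul0mx addr0.
have -> : Z^T *m J *m X = - (X^T *m J *m Z)^T.
  by rewrite !trmx_mul trmxK trmx_Jmx mulNmx mulmxN opprK mulmxA.
by rewrite XJZ [(- W)^T]linearN /= WT opprK subrr.
Qed.

(** * Tangent vectors *)

(** Product rule: along a curve in Sp the matrix g^T J g is constant. *)
Lemma tangent_Sp_linearized (R : realType) (p n : nat) (X Z : 'M[R]_(n + n, p + p)) :
  tangent_space (@Sp R p n) X Z ->
  Z^T *m Jmx R n *m X + X^T *m Jmx R n *m Z = 0.
Proof.
move=> [e [g [e0 sg Mg <- <-]]].
have I0 : `]- e, e[%classic (0 : R) by rewrite /= in_itv /= oppr_lt0 e0.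
have g' : is_derive (0 : R) 1 g (g^`()%classic 0).
  by rewrite derive1E; apply: derivableP; exact: (sg 0%N 0 I0).
have J' : is_derive (0 : R) 1 (cst (Jmx R n)) 0 by exact: is_derive_cst.
have [_] := is_derive_mulmx (is_derive_mulmx (is_derive_trmx g') J') g'.
rewrite mulmx0 addr0 => <-.
rewrite (near_eq_derive _ (g := cst (Jmx R p))) ?derive_cst//.
have oI : open `]- e, e[%classic by exact: interval_open.
by apply: filterS (open_nbhs_nbhs (conj oI I0)) => t; exact: Mg.
Qed.

(** S J is skew for the form J, so the Cayley transforms of t S J / 2 preserve
    this form and carry X along a curve that stays in Sp. They are rational in t,
    hence smooth, and their derivative at 0 is S J. *)
Lemma Hamiltonian_tangent_Sp (R : realType) (p n : nat)
    (X : 'M[R]_(n + n, p + p)) (S : 'M[R]_(n + n)) :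
  Sp X -> Ssym S -> tangent_space (@Sp R p n) X (S *m Jmx R n *m X).
Proof.
move=> XX /SsymP ST; set J := Jmx R n.
(* The factor 1/2 compensates for the Cayley transform having derivative 2 B. *)
pose B := 2^-1 *: (S *m J).
have BJ : B^T *m J = - (J *m B).
  rewrite /B linearZ /= trmx_mul ST trmx_Jmx -scalemxAl -scalemxAr.
  by rewrite !mulNmx scalerN mulmxA.
pose M s := invmx (1%:M - s *: B).
have [e e0 Ue] : exists2 e : R, 0 < e &
    forall t, t \in `]- e, e[ -> 1%:M - t *: B \in unitmx.
  have : \forall t \near (0 : R), 1%:M - t *: B \in unitmx.
    by apply: near_unit_resolvent; rewrite scale0r subr0 unitmx1.
  move=> /nbhs_ballP[e /= e0 He]; exists e => // t te; apply: He.
  by rewrite /ball /= sub0r normrN ltr_norml; move: te; rewrite in_itv.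
pose F j s := iter j (mulmx (M s *m B)) (M s *m X).
(* G k is the k-th derivative of the curve G 0 s = (2 M s - 1) X; the constant
   - X only shows up for k = 0. *)
pose G k s := (2 * k`!%:R) *: F k s - (k == 0%N)%:R *: X.
have G' k t : t \in `]- e, e[ -> is_derive t 1 (G k) (G k.+1 t).
  move=> /Ue Ut; have F' := is_derive_iter_resolvent X k Ut.
  have -> : G k = ((2 * k`!%:R) \*: F k) - cst ((k == 0%N)%:R *: X).
    by apply/funext.
  apply: is_derive_eq; rewrite /G subr0 scale0r subr0 scalerA.
  by rewrite factS natrM mulrAC mulrA.
exists e, (G 0%N); split => //.
- have oI : open `]- e, e[%classic by exact: interval_open.
  by apply: (smooth_on_derivative_sequence (F := G) oI) => k t; exact: G'.
- move=> t /Ue Ut.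
  pose C := 2 *: M t - 1%:M.
  have -> : G 0%N t = C *m X.
    by rewrite /G /F /= scale1r mulr1 mulmxBl mul1mx scalemxAl.
  have CJC : C^T *m J *m C = J.
    apply: Cayley_preserves_form => //.
    by rewrite linearZ /= -scalemxAl BJ scalerN scalemxAr.
  by rewrite /Sp /= trmx_mul !mulmxA -[_ *m C^T *m _]mulmxA -[_ *m C]mulmxA CJC.
- rewrite /G /F /M /= scale0r subr0 invmx1 mul1mx mulr1 scale1r.
  by rewrite scaler_nat mulr2n addrK.
- have [|_] := G' 0%N 0; first by rewrite in_itv /= oppr_lt0 e0.
  rewrite derive1E => ->; rewrite /G /F /M /= scale0r !subr0 invmx1 !mul1mx mulr1.
  by rewrite scale0r subr0 /B -scalemxAl scalerA divff ?pnatr_eq0// scale1r.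
Qed.

(** * The three descriptions of the tangent space *)

Theorem proposition3p3 (R : realType) (p n : nat)
    (hp : (0 < p)%N) (hpn : (p <= n)%N)
    (X : 'M[R]_(n + n, p + p)) (hX : Sp X)
    (Xperp : 'M[R]_(n + n, (n + n) - (p + p)))
    (hrank : \rank Xperp = ((n + n) - (p + p))%N)
    (hperp : colspan Xperp = orthocompl (colspan X)) :
  [/\ tangent_space (@Sp R p n) X =
        [set Z : 'M[R]_(n + n, p + p) |
          Z^T *m Jmx R n *m X + X^T *m Jmx R n *m Z = 0],
      [set Z : 'M[R]_(n + n, p + p) |
          Z^T *m Jmx R n *m X + X^T *m Jmx R n *m Z = 0] =
        [set Z : 'M[R]_(n + n, p + p) |
          exists (W : 'M[R]_(p + p)) (K : 'M[R]_((n + n) - (p + p), p + p)),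
            Ssym W /\ Z = X *m Jmx R p *m W + Jmx R n *m Xperp *m K] &
      [set Z : 'M[R]_(n + n, p + p) |
          exists (W : 'M[R]_(p + p)) (K : 'M[R]_((n + n) - (p + p), p + p)),
            Ssym W /\ Z = X *m Jmx R p *m W + Jmx R n *m Xperp *m K] =
        [set Z : 'M[R]_(n + n, p + p) |
          exists S : 'M[R]_(n + n), Ssym S /\ Z = S *m Jmx R n *m X]].
Proof.
have XY := orthocompl_colspan_mulmx0 hperp.
split; apply/seteqP; split=> Z /=.
- exact: tangent_Sp_linearized.
- move=> /(linearized_Hamiltonian hX)[S [SS ->]]; exact: Hamiltonian_tangent_Sp.
- exact: linearized_decomposition hX hperp.
- by move=> [W [K [WW ->]]]; exact: decomposition_linearized.
- move=> [W [K [WW ->]]]; apply: linearized_Hamiltonian => //.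
  exact: decomposition_linearized.
- move=> [S [SS ->]]; apply: (linearized_decomposition hX hperp).
  exact: Hamiltonian_linearized.
Qed.
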